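(* The verification problem for counterfactual witnesses (CW) is in PTIME. Here the problem takes as input a graph $G$, a subgraph $G_s$ of $G$, a set $V_T$ of test nodes of $G$, and the inference function $M$ of a fixed deterministic graph neural network, and decides whether $G_s$ is a counterfactual witness for $V_T$, i.e. whether for every test node $v\in V_T$, $G_s$ is a counterfactual witness of $M(v,G)=l$.
   Context: $G=(V,E)$ is a connected graph with a feature vector at every node. The inference function $M$ of a GNN-based node classifier is a polynomial-time computable function assigning to a test node $v$ and a graph a class label $M(v,G)=l$ from a finite label set. The GNN is fixed (all factors determining $M$ are fixed) and deterministic (same input gives same output). $M(v,\emptyset)$ is undefined (regarded as different from $l$). $G\setminus G_w$ is the graph obtained from $G$ by removing all edges of the subgraph $G_w$ while keeping all nodes. A subgraph $G_w$ of $G$ is a factual witness of $M(v,G)=l$ if $M(v,G_w)=l$ (in particular $v$ is a node of $G_w$); it is a counterfactual witness (CW) of $M(v,G)=l$ if it is a factual witness of $M(v,G)=l$ and $M(v,G\setminus G_w)\neq l$. *)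

(* Defs.v *)
From HB Require Import structures.
From mathcomp Require Import all_boot all_order all_algebra.

Set Implicit Arguments.
Unset Strict Implicit.
Unset Printing Implicit Defensive.

Import GRing.Theory.

(* A cell is blank ([None]), holds a symbol of the input/output alphabet
   ([Some (inl a)]), or holds one of the machine's auxiliary symbols
   ([Some (inr b)]). *)
Definition cell (S X : finType) : finType := option (S + X)%type.

Inductive move := MoveLeft | Stay | MoveRight.

Record machine (S : finType) := Machine {
  ntapes : nat;  (* the machine has [ntapes.+1] tapes, so at least one *)
  aux : finType;
  state : finType;
  start : state;
  halting : pred state;
  delta : state -> {ffun 'I_ntapes.+1 -> cell S aux} ->
          state * ('I_ntapes.+1 -> cell S aux * move)
}.

(* [(l, r)] is a two-way infinite tape: the head scans the first cell of [r],
   [l] lists the cells to its left, nearest first, and every cell not listed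
   is blank. *)
Definition tape (C : Type) : Type := (seq (option C) * seq (option C))%type.

Definition scan (C : Type) (t : tape C) : option C := head None t.2.

Definition act (C : Type) (t : tape C) (a : option C * move) : tape C :=
  let: (l, r) := t in
  let: (c, m) := a in
  match m with
  | MoveLeft => (behead l, head None l :: c :: behead r)
  | Stay => (l, c :: behead r)
  | MoveRight => (c :: l, behead r)
  end.

Section Runs.
Variables (S : finType) (T : machine S).

Definition config : Type :=
  (state T * ('I_(ntapes T).+1 -> tape (S + aux T)))%type.

(* Halting configurations are fixed points, so that "halted at time t" means
   "halted within t steps". *)
Definition step (c : config) : config :=
  let: (q, ts) := c in
  if halting q then c else
  let: (q', a) := delta q [ffun i => scan (ts i)] in
  (q', fun i => act (ts i) (a i)).

Definition init (w : seq S) : config :=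
  (start T,
   fun i => if i == ord0 then ([::], [seq Some (inl a) | a <- w])
            else ([::], [::])).

Fixpoint read (s : seq (cell S (aux T))) : seq S :=
  if s is Some (inl a) :: s' then a :: read s' else [::].

(* The output is read on the first tape, from the head rightwards up to the
   first cell that holds no symbol of [S]. *)
Definition output (c : config) : seq S := read (c.2 ord0).2.

Definition computes_within (w out : seq S) (t : nat) : Prop :=
  let c := iter t step (init w) in halting c.1 /\ output c = out.

End Runs.

Definition polytime (S : finType) (X Y : Type)
    (encX : X -> seq S) (encY : Y -> seq S) (f : X -> Y) : Prop :=
  exists (T : machine S) (p : {poly nat}),
    forall x, computes_within T (encX x) (encY (f x)) (p.[size (encX x)])%R.

Definition symbol : finType := (bool + bool)%type.
Definition bit (b : bool) : symbol := inl b.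
Definition comma : symbol := inr false.
Definition semi : symbol := inr true.

Definition enc_bool (b : bool) : seq symbol := [:: bit b].

(* Binary digits, least significant first; [up_log 2 n.+1] is their number. *)
Definition enc_nat (n : nat) : seq symbol :=
  [seq bit (odd (n %/ 2 ^ i)) | i <- iota 0 (up_log 2 n.+1)].

Definition enc_rat (x : rat) : seq symbol :=
  bit (x < 0)%R :: enc_nat `|numq x|%N ++ comma :: enc_nat `|denq x|%N
    ++ [:: comma].

Definition enc_vec (d : nat) (x : 'rV[rat]_d) : seq symbol :=
  flatten [seq enc_rat (x ord0 j) | j <- enum 'I_d].

Definition enc_bits (n : nat) (A : {set 'I_n}) : seq symbol :=
  [seq bit (i \in A) | i <- enum 'I_n].

Definition enc_set (n : nat) (A : {set 'I_n}) : seq symbol :=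
  enc_bits A ++ [:: semi].

(* A class label is written in unary through its rank in [L]; the empty string
   stands for "undefined". *)
Definition enc_label (L : finType) (o : option L) : seq symbol :=
  if o is Some l then nseq (enum_rank l).+1 (bit true) else [::].

Definition in_PTIME (X : Type) (enc : X -> seq symbol) (P : X -> Prop) : Prop :=
  exists2 b : X -> bool, polytime enc enc_bool b & forall x, P x <-> b x.

(* A finite simple undirected graph with nodes named in ['I_n]; its node set
   need not be all of ['I_n], so that a graph and its subgraphs have the same
   type.  Edges are two-element sets of nodes. Features are rational, and set
   to [0] on the names that are not nodes, so that the record carries no more
   information than the graph. *)
Record graph (d n : nat) := Graph {
  nodes : {set 'I_n};
  edges : {set {set 'I_n}};
  feat : {ffun 'I_n -> 'rV[rat]_d};
  edgesP : [forall e in edges, (#|e| == 2) && (e \subset nodes)];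
  featP : [forall i, (i \notin nodes) ==> (feat i == 0%R)]
}.

Definition adj (d n : nat) (G : graph d n) : rel 'I_n :=
  fun i j => [set i; j] \in edges G.

Definition connected (d n : nat) (G : graph d n) : Prop :=
  {in nodes G &, forall u v, connect (adj G) u v}.

Definition subgraph (d n : nat) (H G : graph d n) : Prop :=
  [/\ nodes H \subset nodes G, edges H \subset edges G
    & {in nodes H, feat H =1 feat G}].

Lemma edges_removed (d n : nat) (G H : graph d n) :
  [forall e in edges G :\: edges H, (#|e| == 2) && (e \subset nodes G)].
Proof.
apply/forall_inP => e; rewrite inE => /andP[_].
exact: (forall_inP (edgesP G)).
Qed.

Definition remove_edges (d n : nat) (G H : graph d n) : graph d n :=
  Graph (edges_removed G H) (featP G).

(* Node bit vector; features of the nodes in increasing order; adjacency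
   matrix, row by row. *)
Definition enc_graph (d n : nat) (G : graph d n) : seq symbol :=
  enc_set (nodes G)
  ++ flatten [seq enc_vec (feat G i) | i <- enum (nodes G)] ++ [:: semi]
  ++ flatten [seq enc_bits [set j | adj G i j] ++ [:: comma] | i <- enum 'I_n]
  ++ [:: semi].

(* [None] means "undefined", which differs from every label [Some l].  Nothing
   forbids [M v H = None] on other graphs [H], e.g. edgeless ones. *)
Definition inference (d : nat) (L : finType) : Type :=
  forall n, 'I_n -> graph d n -> option L.

Definition undefined_off_nodes (d : nat) (L : finType) (M : inference d L) :=
  forall n (v : 'I_n) (H : graph d n), v \notin nodes H -> M n v H = None.

Record query (d : nat) := Query {
  q_order : nat;
  q_node : 'I_q_order;
  q_graph : graph d q_order;
  q_nodeP : q_node \in nodes q_graph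
}.

Definition enc_query (d : nat) (q : query d) : seq symbol :=
  enc_set [set q_node q] ++ enc_graph (q_graph q).

(* The running time is only constrained on queries about a node of the graph. *)
Definition polytime_inference (d : nat) (L : finType) (M : inference d L) :=
  polytime (@enc_query d) (@enc_label L)
    (fun q => M (q_order q) (q_node q) (q_graph q)).

Section Witnesses.
Variables (d : nat) (L : finType) (M : inference d L).
Variables (n : nat) (v : 'I_n) (G : graph d n) (l : L) (Gw : graph d n).

Definition factual_witness : Prop :=
  [/\ subgraph Gw G, M v G = Some l & M v Gw = Some l].

Definition counterfactual_witness : Prop :=
  factual_witness /\ M v (remove_edges G Gw) <> Some l.

End Witnesses.

Record cw_instance (d : nat) := CWInstance {
  cw_order : nat;
  cw_graph : graph d cw_order;
  cw_sub : graph d cw_order;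
  cw_tests : {set 'I_cw_order};
  cw_connected : connected cw_graph;
  cw_subP : subgraph cw_sub cw_graph;
  cw_testsP : cw_tests \subset nodes cw_graph
}.

Definition enc_instance (d : nat) (x : cw_instance d) : seq symbol :=
  enc_graph (cw_graph x) ++ enc_graph (cw_sub x) ++ enc_set (cw_tests x).

Definition is_cw (d : nat) (L : finType) (M : inference d L)
    (x : cw_instance d) : Prop :=
  forall v, v \in cw_tests x ->
    exists l : L, counterfactual_witness M v (cw_graph x) l (cw_sub x).

(* Main.v *)
From HB Require Import structures.
Require Import Defs.
From mathcomp Require Import all_boot all_order all_algebra.
From mathcomp Require Import zify.

Set Implicit Arguments.
Unset Strict Implicit.
Unset Printing Implicit Defensive.

(* A decider is written as a structured program on finitely many stacks, one
   per tape: a step looks at all the tops and replaces each of them by at most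
   two symbols, which a Turing machine does in two moves.  The encoding of an
   instance consists of seven segments closed by [semi], so one pass over it
   yields the encodings of [G], of [G_s] and, by comparing the two adjacency
   matrices bit by bit, of [G \ G_s].  For every test node [v], prefixing each
   of the three by the one-hot vector of [v] gives a query to the machine
   computing [M]; its tapes are simulated by pairs of stacks, and its three
   unary answers are compared.  The order of the graph and the lengths of the
   queries are at most the length [w] of the input, so with a polynomial bound
   [p] for [M] the total time is [O(w (w + p(w)))]. *)

(** * Stack programs and their compilation *)

Section Programs.
Variables (C I : finType).

Inductive upd := Drop | Put of C | Push of C & C.

Definition upd_seq (u : upd) : seq C :=
  match u with Drop => [::] | Put a => [:: a] | Push a b => [:: a; b] end.

Definition store : Type := {ffun I -> seq C}.
Definition tops : Type := {ffun I -> option C}.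

Definition top (s : store) : tops := [ffun x => ohead (s x)].

Definition update (s : store) (u : I -> upd) : store :=
  [ffun x => upd_seq (u x) ++ behead (s x)].

(** An update always discards the current top, so leaving a stack unchanged means writing its top
    back; on an empty stack this is [Drop]. *)
Definition keep (o : option C) : upd := if o is Some a then Put a else Drop.
Definition push (a : C) (o : option C) : upd :=
  if o is Some b then Push a b else Put a.

Lemma keepE s : upd_seq (keep (ohead s)) ++ behead s = s.
Proof. by case: s. Qed.

Lemma pushE a s : upd_seq (push a (ohead s)) ++ behead s = a :: s.
Proof. by case: s. Qed.

Record prog := Prog {
  point : finType;
  entry : point;
  next : point -> tops -> option point * (I -> upd)
}.

(** The number is only an upper bound on the steps: a finished run may declare any time, so costs
    can be rounded up. *)
Inductive run (p : prog) :
    option (point p) -> store -> nat -> store -> Prop :=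
| run_exit s t : run None s t s
| run_next q s t s' :
    run (next q (top s)).1 (update s (next q (top s)).2) t s' ->
    run (Some q) s t.+1 s'.

Definition runs (p : prog) := run (Some (entry p)).

Lemma run_leq p o s t t' s' : @run p o s t s' -> t <= t' -> run o s t' s'.
Proof.
move=> r; elim: r t' => [*|q s0 t0 s1 _ IH [//|t'] le_t]; first exact: run_exit.
by apply: run_next; apply: IH.
Qed.

Lemma runs_eq p s t t' s' s'' :
  runs p s t s' -> s' = s'' -> t <= t' -> runs p s t' s''.
Proof. by move=> r <-; apply: run_leq. Qed.

Definition do_ (f : tops -> I -> upd) : prog :=
  @Prog unit tt (fun _ tp => (None, f tp)).

Lemma runs_do f s : runs (do_ f) s 1 (update s (f (top s))).
Proof. by apply: run_next; apply: run_exit. Qed.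

Section Seq.
Variables p q : prog.

Definition seq_lift (o : option (point p)) : option (point p + point q) :=
  Some (if o is Some a then inl a else inr (entry q)).

Definition seq_ : prog :=
  @Prog (point p + point q)%type (inl (entry p)) (fun a tp =>
    match a with
    | inl b => (seq_lift (next b tp).1, (next b tp).2)
    | inr b => (omap inr (next b tp).1, (next b tp).2)
    end).

Lemma runs_seq s t s1 t' s2 :
  runs p s t s1 -> runs q s1 t' s2 -> runs seq_ s (t + t') s2.
Proof.
(* With the entry point written through [seq_lift], the induction on the run of [p] also covers its
   exit, where control jumps to [q]. *)
move=> rp rq; rewrite /runs -[Some _]/(seq_lift (Some (entry p))).
have {}rq : @run seq_ (Some (inr (entry q))) s1 t' s2.
  rewrite -[Some _]/(omap inr (Some (entry q))).
  elim: rq => [*|b s0 t0 s3 _ IH]; [exact: run_exit | exact: run_next].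
elim: rp rq => [s0 t0|b s0 t0 s3 _ IH] rq.
  by apply: run_leq rq _; apply: leq_addl.
by rewrite addSn; apply: run_next; apply: IH.
Qed.

End Seq.

Section Guarded.
Variables (c : tops -> bool) (p : prog).

(** Loop and conditional share a control graph: [None] is the test, [Some b] a point of the body.
    They differ only in where the exit of the body leads. *)
Definition guard (loop : bool) : prog :=
  @Prog (option (point p)) None (fun a tp =>
    if a is Some b then
      (if (next b tp).1 is Some b' then Some (Some b')
       else if loop then Some None else None, (next b tp).2)
    else (if c tp then Some (Some (entry p)) else None,
          fun x => keep (tp x))).

Definition while := guard true.
Definition when := guard false.

Lemma update_keep s : update s (fun x => keep (top s x)) = s.
Proof. by apply/ffunP => x; rewrite !ffunE keepE. Qed.

Lemma runs_guardF loop s : ~~ c (top s) -> runs (guard loop) s 1 s.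
Proof.
move=> /negPf cF; apply: run_next; rewrite /= cF update_keep.
exact: run_exit.
Qed.

Lemma run_guard_body loop o s t s1 t' s2 : run o s t s1 ->
  @run (guard loop) (if loop then Some None else None) s1 t' s2 ->
  @run (guard loop) (if o is Some b then Some (Some b)
                     else if loop then Some None else None) s (t + t') s2.
Proof.
elim=> {o s t s1} [s t|b s t s1 _ IH] rg.
  by apply: run_leq rg _; apply: leq_addl.
by rewrite addSn; apply: run_next; apply: IH.
Qed.

Lemma runs_whileT s t s1 t' s2 : c (top s) -> runs p s t s1 ->
  runs while s1 t' s2 -> runs while s (t + t').+1 s2.
Proof.
move=> cT rp rw; apply: run_next; rewrite /= cT update_keep.
exact: (@run_guard_body true _ _ _ _ _ _ rp rw).
Qed.

Lemma runs_whenT s t s1 : c (top s) -> runs p s t s1 ->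
  runs when s t.+1 s1.
Proof.
move=> cT rp; apply: run_next; rewrite /= cT update_keep -[t]addn0.
exact: (@run_guard_body false _ _ _ _ 0 s1 rp (run_exit _ _ _)).
Qed.

End Guarded.
End Programs.

Arguments Drop {C}.

(** * Compiling stack programs into multitape Turing machines *)

Section Compile.
Variables (S X I : finType) (x0 : I).
Let C : finType := (S + X)%type.
Variable p : prog C I.

(* Tape [ord0] is the stack [x0]; [x0] also occurs among the other tapes, but
   that copy is never consulted. *)
Definition stack_of (j : 'I_#|I|.+1) : I :=
  if unlift ord0 j is Some k then enum_val k else x0.
Definition tape_of (x : I) : 'I_#|I|.+1 :=
  if x == x0 then ord0 else lift ord0 (enum_rank x).

Lemma tape_ofK : cancel tape_of stack_of.
Proof.
move=> x; rewrite /tape_of /stack_of; case: eqP => [->|_].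
  by rewrite unlift_none.
by rewrite liftK enum_rankK.
Qed.

(* One step takes two moves: the first one rewrites the top symbol, and makes
   room if a second symbol has to be pushed; that symbol waits in the state. *)
Definition write1 (u : upd C) : cell S X * move :=
  match u with
  | Drop => (None, MoveRight)
  | Put a => (Some a, Stay)
  | Push _ b => (Some b, MoveLeft)
  end.

Definition pending (u : upd C) : option C :=
  if u is Push a _ then Some a else None.

Definition write2 (o : option C) (c : cell S X) : cell S X * move :=
  (if o is Some a then Some a else c, Stay).

Definition stack_machine : machine S :=
  @Machine S #|I| X
    (option (point p) * option {ffun 'I_#|I|.+1 -> option C})%type
    (Some (entry p), None)
    (fun q => (q.1 == None) && (q.2 == None))
    (fun q sc =>
      match q.2, q.1 with
      | Some w, o => ((o, None), fun j => write2 (w j) (sc j))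
      | None, Some b =>
          let: (o, u) := next b [ffun x => sc (tape_of x)] in
          ((o, Some [ffun j => pending (u (stack_of j))]),
           fun j => write1 (u (stack_of j)))
      | None, None => (q, fun j => (sc j, Stay))
      end).

(** The head is on the top of the stack. Popped cells stay listed as blanks, so the tape is fixed
    only up to blanks on both sides. *)
Definition holds (t : tape C) (s : seq C) : Prop :=
  exists k m, t = (nseq k None, map Some s ++ nseq m None).

Lemma scan_holds t s : holds t s -> scan t = ohead s.
Proof. by case=> k [m ->]; case: s => //=; case: m. Qed.

Lemma holds_write t s u : holds t s ->
  let t1 := act t (write1 u) in
  holds (act t1 (write2 (pending u) (scan t1))) (upd_seq u ++ behead s).
Proof.
case=> k [m ->].
have [m' E] : exists m', behead (map Some s ++ nseq m None)
   = map Some (behead s) ++ nseq m' None.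
  by case: s => [|a s]; [exists m.-1; case: m | exists m].
case: u => [|a|a b] /=; rewrite E {E}.
- rewrite /holds; case: (behead s) => [|b s'] /=; last by exists k.+1, m'.
  (* The second move writes the scanned blank back, so one blank is listed even when [m'] is 0. *)
  by exists k.+1, m'.-1.+1; case: m' .
- by exists k, m'.
- by exists k.-1, m'; case: k.
Qed.

Definition simulates (ts : 'I_#|I|.+1 -> tape C) (s : store C I) : Prop :=
  forall x, holds (ts (tape_of x)) (s x).

Lemma step_simulates b ts s : simulates ts s ->
  exists2 ts', simulates ts' (update s (next b (top s)).2) &
    iter 2 (@step S stack_machine) ((Some b, None), ts)
      = (((next b (top s)).1, None), ts').
Proof.
move=> sim; rewrite /= /step /=.
have -> : [ffun x => [ffun i => scan (ts i)] (tape_of x)] = top s.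
  by apply/ffunP => x; rewrite !ffunE; apply: scan_holds.
case: (next b (top s)) => o u /=; rewrite andbF.
eexists; last by [].
move=> x; rewrite !ffunE tape_ofK.
exact: holds_write.
Qed.

Lemma run_simulates o s t s' : run o s t s' -> forall ts, simulates ts s ->
  exists2 ts', simulates ts' s' &
    iter (2 * t) (@step S stack_machine) ((o, None), ts) = ((None, None), ts').
Proof.
elim=> {o s t s'} [s t|b s t s' _ IH] ts sim.
  (* Leftover time is harmless: the halted configuration is a fixed point of [step]. *)
  by exists ts => //; elim: (2 * t) => //= n ->.
have [ts1 sim1 run1] := step_simulates b sim.
have [ts2 sim2 run2] := IH _ sim1.
by exists ts2; rewrite // mulnS addnC iterD run1.
Qed.

Definition input_store (w : seq S) : store C I :=
  [ffun x => if x == x0 then map inl w else [::]].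

Lemma stack_machine_computes w t s out :
  runs p (input_store w) t s -> s x0 = map inl out ->
  computes_within stack_machine w out (2 * t).
Proof.
move=> r s_out; rewrite /computes_within.
have [|ts sim run] := run_simulates r (ts := (init stack_machine w).2).
  move=> x; rewrite /tape_of ffunE /=; case: (x == x0) => /=.
    by exists 0, 0; rewrite cats0 -map_comp.
  by exists 0, 0.
rewrite /init in run *; rewrite run; split=> //.
have [k [m]] := sim x0; rewrite /tape_of eqxx s_out /output /= => ->.
rewrite -map_comp; elim: out {s_out} => [|a s1 IH] /=; first by case: m.
by rewrite IH.
Qed.

End Compile.

(** * Routines that move, copy and erase stacks *)

Section Routines.
Variables (C I : finType).
Implicit Types (s : store C I) (i x : I) (w : seq C).

Definition assign s i w : store C I := [ffun x => if x == i then w else s x].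

Lemma assign_id s i w : assign s i w i = w.
Proof. by rewrite ffunE eqxx. Qed.

Lemma assign_neq s i w x : x != i -> assign s i w x = s x.
Proof. by rewrite ffunE => /negPf ->. Qed.

Lemma assign_assign s i w w' : assign (assign s i w) i w' = assign s i w'.
Proof. by apply/ffunP => x; rewrite !ffunE; case: eqP. Qed.

Definition alter i (f : tops C I -> option C -> upd C) : prog C I :=
  do_ (fun tp x => if x == i then f tp (tp x) else keep (tp x)).

Lemma runs_alter i f s :
  runs (alter i f) s 1
    (assign s i (upd_seq (f (top s) (ohead (s i))) ++ behead (s i))).
Proof.
apply: runs_eq (runs_do _ _) _ _ => //; apply/ffunP => x; rewrite !ffunE.
by case: eqP => [->|_]; rewrite ?ffunE ?keepE.
Qed.

(** One pass serves several destinations: [g] selects them and gives the recoding used for each.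
    Popping and pushing reverses the order. *)
Definition transfer (P : pred C) i (g : I -> option (C -> C)) : prog C I :=
  while (fun tp => if tp i is Some a then P a else false)
    (do_ (fun tp x =>
       if x == i then Drop
       else match g x, tp i with
            | Some h, Some a => push (h a) (tp x)
            | _, _ => keep (tp x)
            end)).

Lemma runs_transfer (P : pred C) i g s w rest :
  s i = w ++ rest -> all P w ->
  ~~ (if ohead rest is Some a then P a else false) ->
  runs (transfer P i g) s (2 * size w).+1
    [ffun x => if x == i then rest
               else if g x is Some h then rev (map h w) ++ s x else s x].
Proof.
move=> + + Prest; elim: w s => [|a w IH] s /= si.
  move=> _; apply: runs_eq (runs_guardF _ _ _) _ _ => //.
    by rewrite ffunE si.
  apply/ffunP => x; rewrite !ffunE.
  by case: eqP => [->|_]; [rewrite si | case: (g x)].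
case/andP => Pa Pw; rewrite mulnS.
apply: runs_eq (runs_whileT _ (runs_do _ _) (IH _ _ Pw)) _ _ => //.
- by rewrite ffunE si.
- by rewrite !ffunE eqxx si.
apply/ffunP => x; rewrite !ffunE; case: eqP => // /eqP/negPf nx.
rewrite si; case: (g x) => [h|] /=; last by rewrite keepE.
by rewrite pushE rev_cons cat_rcons.
Qed.

(** The first pass empties [i] onto [tmp] and [o], the second restores [i] from [tmp]; the copy on
    [o] is therefore reversed. *)
Definition copy i tmp o (h : C -> C) : prog C I :=
  seq_ (transfer predT i (fun x => if x == tmp then Some id
                                   else if x == o then Some h else None))
       (transfer predT tmp (fun x => if x == i then Some id else None)).

Lemma runs_copy i tmp o h s : i != tmp -> o != tmp -> o != i -> s tmp = [::] ->
  runs (copy i tmp o h) s (4 * size (s i) + 2)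
    (assign s o (rev (map h (s i)) ++ s o)).
Proof.
move=> n_it n_ot n_oi s_tmp.
apply: runs_eq.
- apply: runs_seq.
    by apply: (@runs_transfer predT _ _ _ (s i) [::]);
      rewrite ?cats0 ?all_predT.
  apply: (@runs_transfer predT _ _ _ (rev (s i)) [::]); rewrite ?all_predT //.
  by rewrite ffunE eq_sym (negPf n_it) eqxx map_id s_tmp.
- apply/ffunP => x; rewrite !ffunE; case: (x =P tmp) => [->|_].
    by rewrite eq_sym (negPf n_ot).
  case: (x =P i) => [->|_]; last by case: (x =P o) => // ->.
  by rewrite eq_sym (negPf n_oi) map_id revK cats0.
by rewrite size_rev; lia.
Qed.

(** All marked stacks are popped together, so the cost is governed by the longest one. *)
Definition erase (m : pred I) : prog C I :=
  while (fun tp => [exists x, m x && (tp x != None)])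
    (do_ (fun tp x => if m x then Drop else keep (tp x))).

Lemma runs_erase (m : pred I) s b : (forall x, m x -> size (s x) <= b) ->
  runs (erase m) s (2 * b).+1 [ffun x => if m x then [::] else s x].
Proof.
have stop s' : (forall x, m x -> s' x = [::]) ->
    runs (erase m) s' 1 [ffun x => if m x then [::] else s' x].
  move=> s0; apply: runs_eq (runs_guardF _ _ _) _ _ => //.
    by apply/existsPn => x; rewrite ffunE; case: (boolP (m x)) => //= /s0 ->.
  by apply/ffunP => x; rewrite ffunE; case: ifP => // /s0.
elim: b s => [|b IH] s le_b.
  by apply: stop => x /le_b; case: (s x).
case: (boolP [exists x, m x && (top s x != None)]) => [c|/existsPn c].
  rewrite mulnS.
  apply: runs_eq (runs_whileT c (runs_do _ _) (IH _ _)) _ _ => //.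
    by move=> x mx; rewrite ffunE mx size_behead; have := le_b _ mx; lia.
  apply/ffunP => x; rewrite !ffunE; case: (m x) => //.
  by rewrite keepE.
apply: runs_eq (stop _ _) _ _ => // x mx.
by have := c x; rewrite mx ffunE; case: (s x).
Qed.

End Routines.

Arguments erase {C I}.

(** * Simulating a machine on stacks *)

(** [In] is the unread input, [NodesH] the node bits of [G_s] still to be visited; [Done] has one
    symbol per visited node and [Bad] one per failed test node. [St], [TapeL] and [TapeR] hold a
    configuration of the simulated machine; the indices of [Query_] and [Answer] stand for [G],
    [G_s] and [G \ G_s]. *)
Inductive reg (k : nat) :=
| In | Tmp | AdjG | AdjH | NodesH | Done | Bad | St
| Query_ of 'I_3 | Answer of 'I_3 | TapeL of 'I_k | TapeR of 'I_k.

Arguments In {k}. Arguments Tmp {k}. Arguments AdjG {k}. Arguments AdjH {k}.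
Arguments NodesH {k}. Arguments Done {k}. Arguments Bad {k}. Arguments St {k}.
Arguments Query_ {k}. Arguments Answer {k}.

Definition reg_code k (x : reg k) : 'I_8 + (bool * 'I_3 + bool * 'I_k) :=
  match x with
  | In => inl (@Ordinal 8 0 isT)
  | Tmp => inl (@Ordinal 8 1 isT)
  | AdjG => inl (@Ordinal 8 2 isT)
  | AdjH => inl (@Ordinal 8 3 isT)
  | NodesH => inl (@Ordinal 8 4 isT)
  | Done => inl (@Ordinal 8 5 isT)
  | Bad => inl (@Ordinal 8 6 isT)
  | St => inl (@Ordinal 8 7 isT)
  | Query_ j => inr (inl (false, j))
  | Answer j => inr (inl (true, j))
  | TapeL j => inr (inr (false, j))
  | TapeR j => inr (inr (true, j))
  end.

Definition reg_decode k (y : 'I_8 + (bool * 'I_3 + bool * 'I_k)) : reg k :=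
  match y with
  | inl i => nth In [:: In; Tmp; AdjG; AdjH; NodesH; Done; Bad; St] i
  | inr (inl (b, j)) => if b then Answer j else Query_ j
  | inr (inr (b, j)) => if b then TapeR j else TapeL j
  end.

Lemma reg_codeK k : cancel (@reg_code k) (@reg_decode k).
Proof. by case. Qed.

HB.instance Definition _ k := Finite.copy (reg k) (can_type (@reg_codeK k)).

(** A left move from an empty right half lists two cells at once, hence the factor 2. The bound
    controls the cost of erasing the tapes after a simulation. *)
Lemma size_run (S : finType) (T : machine S) (w : seq S) t i :
  let c := iter t (@step S T) (init T w) in
  size (c.2 i).1 <= 2 * t /\ size (c.2 i).2 <= size w + 2 * t.
Proof.
elim: t => [|t IH] /=.
  by case: eqP; rewrite /= ?size_map; split; lia.
case: (iter t _ _) IH => q ts /= [IH1 IH2].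
case: ifP => _ /=; first by split; lia.
case: (delta _ _) => q' a /=; case: (ts i) IH1 IH2 => l r /=.
by case: (a i) => c [] /=; rewrite !size_behead; split; lia.
Qed.

Lemma step_iter_halted (S : finType) (T : machine S) t (c : config T) :
  halting c.1 -> iter t (@step S T) c = c.
Proof.
by elim: t => //= t IH hc; rewrite IH //; case: c hc {IH} => q ts /= ->.
Qed.

Section Simulation.
Variables (T : machine symbol) (m : nat).

Local Notation Reg := (reg (ntapes T).+1).

(* Besides the input symbols, stacks hold cells of the tapes of [T], its
   states, and counters up to [m]. *)
Definition sym : finType :=
  (symbol + (cell symbol (aux T) + (state T + 'I_m.+1)))%type.

Definition cell_sym (c : cell symbol (aux T)) : sym := inr (inl c).
Definition state_sym (q : state T) : sym := inr (inr (inl q)).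
(** [inord] sends values above [m] to 0, so outputs must be known to have length at most [m]. *)
Definition count_sym (n : nat) : sym := inr (inr (inr (inord n))).
Definition input_cell (a : symbol) : sym := cell_sym (Some (inl a)).

(** The part of a tape below the bottom of its stack is blank. *)
Definition cell_of (o : option sym) : cell symbol (aux T) :=
  if o is Some (inr (inl c)) then c else None.

Lemma cell_of_ohead s : cell_of (ohead (map cell_sym s)) = head None s.
Proof. by case: s. Qed.

Implicit Types s : store sym Reg.

Definition sim_step : prog sym Reg := do_ (fun (tp : tops sym Reg) (x : Reg) =>
  if tp St is Some (inr (inr (inl q))) then
    let: (q', a) := delta q [ffun i => cell_of (tp (TapeR i))] in
    match x with
    | St => Put (state_sym q')
    | TapeL i =>
        match (a i).2 with
        | MoveLeft => Drop
        | Stay => keep (tp x)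
        | MoveRight => push (cell_sym (a i).1) (tp x)
        end
    | TapeR i =>
        match (a i).2 with
        | MoveLeft =>
            Push (cell_sym (cell_of (tp (TapeL i)))) (cell_sym (a i).1)
        | Stay => Put (cell_sym (a i).1)
        | MoveRight => Drop
        end
    | _ => keep (tp x)
    end
  else keep (tp x)).

Definition simulate : prog sym Reg :=
  while (fun tp => if tp St is Some (inr (inr (inl q))) then ~~ halting q
                   else false) sim_step.

Definition store_config s (c : config T) : store sym Reg :=
  [ffun x => match x with
             | St => [:: state_sym c.1]
             | TapeL i => map cell_sym (c.2 i).1
             | TapeR i => map cell_sym (c.2 i).2
             | _ => s x
             end].

Lemma runs_sim_step s c : ~~ halting c.1 ->
  runs sim_step (store_config s c) 1 (store_config s (step c)).
Proof.
case: c => q ts /= /negPf nh.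
apply: runs_eq (runs_do _ _) _ _ => //; apply/ffunP => x.
rewrite !ffunE /= nh.
have -> : [ffun i => cell_of (top (store_config s (q, ts)) (TapeR i))] =
          [ffun i => scan (ts i)].
  by apply/ffunP => i; rewrite !ffunE /= cell_of_ohead.
case: (delta q _) => q' a /=.
case: x => *; rewrite ?keepE //=; rewrite ?ffunE /=;
  case: (ts _) => l r /=; case: (a _) => c [] //=.
- by case: l.
- by rewrite keepE.
- by rewrite pushE.
- by rewrite cell_of_ohead; case: r.
- by case: r.
- by case: r.
Qed.

Lemma runs_simulate s c t : halting (iter t (@step _ T) c).1 ->
  runs simulate (store_config s c) (2 * t).+1
    (store_config s (iter t (@step _ T) c)).
Proof.
elim: t c => [|t IH] c h.
  by apply: runs_guardF; rewrite !ffunE /= h.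
(* The machine may have halted before time [t]; the loop then stops early. *)
case: (boolP (halting c.1)) => hc.
  rewrite step_iter_halted //; apply: run_leq (runs_guardF _ _ _) _ => //.
  by rewrite !ffunE /= hc.
rewrite iterSr; rewrite iterSr in h; rewrite mulnS.
by apply: runs_whileT (runs_sim_step _ hc) (IH _ h); rewrite !ffunE /= hc.
Qed.

(* Labels are written in unary, so an output is determined by its length,
   which a single counter symbol can hold. *)
Definition count_output (k : 'I_3) : prog sym Reg :=
  while (fun tp =>
      if tp (TapeR ord0) is Some (inr (inl (Some (inl _)))) then true
      else false)
    (do_ (fun (tp : tops sym Reg) (x : Reg) =>
       match x with
       | TapeR j => if j == ord0 then Drop else keep (tp x)
       | Answer j =>
           if (j == k) then
             if tp x is Some (inr (inr (inr i))) then Put (count_sym i.+1)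
             else keep (tp x)
           else keep (tp x)
       | _ => keep (tp x)
       end)).

Lemma runs_count_output k s w n :
  s (TapeR ord0) = map cell_sym w -> s (Answer k) = [:: count_sym n] ->
  n + size (read w) <= m ->
  runs (count_output k) s (2 * size (read w)).+1
    [ffun x => match x with
     | TapeR j => if j == ord0 then drop (size (read w)) (s x) else s x
     | Answer j => if j == k then [:: count_sym (n + size (read w))] else s x
     | _ => s x
     end].
Proof.
elim: w s n => [|c w IH] s n sT sA le_m.
  apply: runs_eq (runs_guardF _ _ _) _ _ => //; first by rewrite ffunE sT.
  apply/ffunP => -[] *; rewrite ffunE ?addn0 ?drop0 //.
    by case: eqP => // ->.
  by case: eqP.
(* Auxiliary symbols and blanks both end the output, so these two cases share one argument. *)
have stop : size (read (c :: w)) = 0 -> ~~ (if ohead (s (TapeR ord0)) is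
    Some (inr (inl (Some (inl _)))) then true else false) ->
  runs (count_output k) s (2 * size (read (c :: w))).+1
    [ffun x => match x with
     | TapeR j => if j == ord0 then drop (size (read (c :: w))) (s x) else s x
     | Answer j =>
         if j == k then [:: count_sym (n + size (read (c :: w)))] else s x
     | _ => s x
     end].
  move=> -> stop; apply: runs_eq (runs_guardF _ _ _) _ _ => //.
    by rewrite ffunE.
  apply/ffunP => -[] *; rewrite ffunE ?addn0 ?drop0 //.
    by case: eqP => // ->.
  by case: eqP.
case: c => [[a|b]|] in sT le_m stop *; try by apply: stop; rewrite ?sT.
move=> {stop}.
rewrite /= in le_m *; rewrite mulnS.
apply: runs_eq (runs_whileT _ (runs_do _ _) (IH _ n.+1 _ _ _)) _ _ => //.
- by rewrite ffunE sT.
- by rewrite ffunE /= sT.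
- by rewrite ffunE /= eqxx ffunE sA /= inordK //; lia.
- by rewrite addSn -addnS.
apply/ffunP => -[||||||||j|j|j|j]; rewrite !ffunE /= ?ffunE ?keepE //.
  by case: (j == k); rewrite ?keepE // addSn -addnS.
by case: eqP => [->|_]; rewrite ?sT ?keepE.
Qed.

End Simulation.

(** * The decider *)

Notation "p ;; q" := (seq_ p q) (at level 60, right associativity).

Definition onehot_query (b a : nat) (g : seq symbol) : seq symbol :=
  nseq b (bit false) ++ bit true :: nseq a (bit false) ++ semi :: g.

Lemma size_onehot_query b a g :
  size (onehot_query b a g) = (b + a + size g).+2.
Proof. by rewrite /onehot_query size_cat /= size_cat /= !size_nseq; lia. Qed.

(** Applied entrywise to two adjacency matrices, it keeps the edges of the first that are not in the
    second, and the separators. *)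
Definition diff_sym (p : symbol * symbol) : symbol :=
  match p with
  | (inl x, inl y) => bit (x && ~~ y)
  | (c, _) => c
  end.

Section Decider.
Variables (T : machine symbol) (m : nat).

Local Notation Reg := (reg (ntapes T).+1).
Local Notation sym := (sym T m).
Local Notation input_cell := (@input_cell T m).
Local Notation count_sym := (@count_sym T m).
Implicit Types s : store sym Reg.

Definition isym (c : symbol) : sym := inl c.

Definition to_cell (c : sym) : sym :=
  if c is inl a then input_cell a else c.

Definition machine_reg (x : Reg) : bool :=
  match x with St | TapeL _ | TapeR _ => true | _ => false end.

(* The query is pushed from its last symbol to its first; [Query_ k] therefore
   holds its last part reversed.  [NodesH] still holds a symbol for the current
   node, so its copy gives one zero too many, which is turned into the one of
   the one-hot vector. *)
Definition ask (k : 'I_3) : prog sym Reg :=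
  copy (Query_ k) Tmp (TapeR ord0) to_cell ;;
  alter (TapeR ord0) (fun _ => push (input_cell semi)) ;;
  copy NodesH Tmp (TapeR ord0) (fun _ => input_cell (bit false)) ;;
  alter (TapeR ord0) (fun _ _ => Put (input_cell (bit true))) ;;
  copy Done Tmp (TapeR ord0) (fun _ => input_cell (bit false)) ;;
  alter St (fun _ _ => Put (state_sym m (start T))) ;;
  alter (Answer k) (fun _ _ => Put (count_sym 0)) ;;
  simulate T m ;;
  count_output T m k ;;
  erase machine_reg.

(** Copying costs about [4 * w], simulating [2 * t], counting [2 * m] and erasing [2 * w + 4 * t];
    20 absorbs the constants. *)
Definition ask_time (w t : nat) : nat := 6 * w + 6 * t + 2 * m + 20.

Lemma map_const (A B : Type) (b : B) (w : seq A) :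
  map (fun _ => b) w = nseq (size w) b.
Proof. by elim: w => //= a w ->. Qed.

Lemma runs_ask k s g a b out t :
  s (Query_ k) = rev (map isym g) -> size (s NodesH) = a.+1 ->
  size (s Done) = b -> s Tmp = [::] -> s (Answer k) = [::] ->
  (forall x, machine_reg x -> s x = [::]) ->
  computes_within T (onehot_query b a g) out t -> size out <= m ->
  runs (ask k) s (ask_time (size (onehot_query b a g)) t)
    (assign s (Answer k) [:: count_sym (size out)]).
Proof.
move=> sQ sN sD sTmp sA sM; set q := onehot_query b a g.
case; set c := iter t _ _ => halt_c out_c le_m.
pose s' := assign s (Answer k) [:: count_sym 0].
(* The instructions before [simulate] produce exactly the initial configuration on [q]. *)
have build : assign (assign (assign s (TapeR ord0) (map input_cell q))
    St [:: state_sym m (start T)]) (Answer k) [:: count_sym 0] =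
    store_config s' (init T q).
  apply/ffunP => -[||||||||j|j|j|j]; rewrite !ffunE //.
    by do 3![case: eqP => // _]; rewrite sM //=; case: eqP.
  do 2![case: eqP => // _]; case: eqP => [[->]|nj].
    by rewrite /= -map_comp.
  by rewrite sM //=; case: eqP => // ej; case: nj; rewrite ej.
apply: runs_eq.
- apply: runs_seq; first by apply: runs_copy.
  apply: runs_seq; first exact: runs_alter.
  rewrite assign_assign assign_id pushE.
  apply: runs_seq; first by apply: runs_copy; rewrite ?assign_neq.
  rewrite assign_assign assign_id assign_neq //.
  apply: runs_seq; first exact: runs_alter.
  rewrite assign_assign assign_id.
  apply: runs_seq; first by apply: runs_copy; rewrite ?assign_neq.
  rewrite assign_assign assign_id assign_neq //.
  apply: runs_seq; first exact: runs_alter.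
  apply: runs_seq; first exact: runs_alter.
  rewrite !assign_neq // sA (sM St) // (sM (TapeR _)) // sQ.
  (* The reversal made by [copy] cancels the one in which [Query_ k] is held. *)
  rewrite map_rev revK -map_comp !map_const !rev_nseq sD sN /= cats0.
  have -> : nseq b (input_cell (bit false)) ++ input_cell (bit true) ::
      nseq a (input_cell (bit false)) ++ input_cell semi ::
      [seq (to_cell \o isym) i | i <- g] = map input_cell q.
    by rewrite /q /onehot_query map_cat /= map_cat /= !map_nseq.
  rewrite build.
  apply: runs_seq; first exact: runs_simulate halt_c.
  apply: runs_seq.
    apply: (@runs_count_output _ _ _ _ (c.2 ord0).2 0).
    - by rewrite ffunE.
    - by rewrite !ffunE eqxx.
    - by rewrite add0n -/(output c) out_c.
  apply: (@runs_erase _ _ _ _ (size q + 2 * t).+1) => -[||||||||j|j|j|j] //= _.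
  + by rewrite !ffunE /=.
  + rewrite !ffunE size_map; have [+ _] := @size_run _ T q t j.
    by move/leq_trans; apply; lia.
  rewrite !ffunE -/(output c) out_c.
  have [_ +] := @size_run _ T q t j=> le.
  case: eqP => [e|_]; rewrite ?size_drop size_map.
    exact: leq_trans (leq_subr _ _) (leqW le).
  exact: leqW le.
- apply/ffunP => -[||||||||j|j|j|j]; rewrite !ffunE //=.
  + by rewrite sM.
  + rewrite -/(output c) out_c.
    by case: eqP => [->|nj]; rewrite ?eqxx //; case: eqP => // -[].
  + by rewrite sM.
  + by rewrite sM.
rewrite !assign_neq // sQ sN sD -/(output c) out_c size_rev size_map.
rewrite /q size_onehot_query /ask_time; move: le_m; move: (size out) => n.
lia.
Qed.

(** * Judging the three answers at each node *)

Definition i1 : 'I_3 := @Ordinal 3 1 isT.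
Definition i2 : 'I_3 := @Ordinal 3 2 isT.

(** Lengths suffice for unary labels. An empty first answer is rejected as undefined, while an empty
    third one counts as different from the label. *)
Definition good_answers (out : 'I_3 -> seq symbol) : bool :=
  [&& size (out ord0) != 0, size (out i1) == size (out ord0)
    & size (out i2) != size (out ord0)].

Definition judge : prog sym Reg := do_ (fun (tp : tops sym Reg) (x : Reg) =>
  match x with
  | Answer _ => Drop
  | Bad =>
      if [&& tp (Answer ord0) != Some (count_sym 0),
             tp (Answer i1) == tp (Answer ord0)
           & tp (Answer i2) != tp (Answer ord0)]
      then keep (tp x) else push (isym (bit true)) (tp x)
  | _ => keep (tp x)
  end).

(** The store between two rounds: simulated machine and answers are empty, and queries are held
    reversed. *)
Definition work (gs : seq (seq symbol)) (inp tmp adjG adjH nodesH : seq symbol)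
    (done bad : nat) : store sym Reg :=
  [ffun x => match x with
   | In => map isym inp
   | Tmp => map isym tmp
   | AdjG => map isym adjG
   | AdjH => map isym adjH
   | NodesH => map isym nodesH
   | Done => nseq done (isym (bit false))
   | Bad => nseq bad (isym (bit true))
   | Query_ j => rev (map isym (nth [::] gs j))
   | _ => [::]
   end].

Lemma count_sym_eq a b : a <= m -> b <= m ->
  (count_sym a == count_sym b) = (a == b).
Proof.
move=> le_a le_b; apply/eqP/eqP => [[]|-> //].
by move/(congr1 val); rewrite /= !inordK // ltnS.
Qed.

Lemma runs_judge s out bad :
  (forall k, size (out k) <= m) ->
  (forall k, s (Answer k) = [:: count_sym (size (out k))]) ->
  s Bad = nseq bad (isym (bit true)) ->
  runs judge s 1
    [ffun x => match x with
               | Answer _ => [::]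
               | Bad => nseq (bad + ~~ good_answers out) (isym (bit true))
               | _ => s x
               end].
Proof.
move=> le_m sA sB; apply: runs_eq (runs_do _ _) _ _ => //.
apply/ffunP => -[||||||||j|j|j|j]; rewrite !ffunE ?keepE //; last by rewrite sA.
rewrite !sA /= /good_answers.
have E a b : a <= m -> b <= m ->
    (Some (count_sym a) == Some (count_sym b)) = (a == b).
  by move=> le_a le_b; rewrite -(count_sym_eq le_a le_b).
rewrite !E // sB; case: ifP => _ /=; first by rewrite keepE addn0.
by rewrite pushE addn1.
Qed.

Definition is_true_bit (o : option sym) : bool := o == Some (isym (bit true)).

Definition ask_all : prog sym Reg := ask ord0 ;; ask i1 ;; ask i2 ;; judge.

(** [In] and [NodesH] are read in step. A test node outside [G_s] is counted as bad without a query,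
    because the machine for [M] is only constrained on queries about a node of the graph. *)
Definition body : prog sym Reg :=
  alter Bad (fun tp => if is_true_bit (tp In) && ~~ is_true_bit (tp NodesH)
                       then push (isym (bit true)) else @keep sym) ;;
  when (fun tp => is_true_bit (tp In) && is_true_bit (tp NodesH)) ask_all ;;
  do_ (fun (tp : tops sym Reg) (x : Reg) =>
    match x with
    | In | NodesH => Drop
    | Done => push (isym (bit false)) (tp x)
    | _ => keep (tp x)
    end).

Lemma ord3_ind (P : 'I_3 -> Prop) : P ord0 -> P i1 -> P i2 -> forall k, P k.
Proof.
move=> P0 P1 P2 [[|[|[|//]]] lt3].
- by rewrite (_ : Ordinal lt3 = ord0) //; apply: val_inj.
- by rewrite (_ : Ordinal lt3 = i1) //; apply: val_inj.
- by rewrite (_ : Ordinal lt3 = i2) //; apply: val_inj.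
Qed.

Lemma runs_ask_all gs inp nodesH a done bad out w t :
  size nodesH = a.+1 ->
  (forall k : 'I_3, let q := onehot_query done a (nth [::] gs k) in
    [/\ computes_within T q (out k) t, size (out k) <= m & size q <= w]) ->
  runs ask_all (work gs inp [::] [::] [::] nodesH done bad)
    (3 * ask_time w t + 1)
    (work gs inp [::] [::] [::] nodesH done (bad + ~~ good_answers out)).
Proof.
move=> size_nodes asked; set s := work _ _ _ _ _ _ _ _.
(* Agreement with [s] is required only off the answers to the other queries, so the three calls can
   be chained. *)
have ask_k k s' : (forall x, (if x is Answer j then j == k else true) ->
     s' x = s x) ->
    runs (ask k) s' (ask_time w t)
      (assign s' (Answer k) [:: count_sym (size (out k))]).
  move=> s's; have [run_k le_k le_w] := asked k.
  apply: run_leq; first apply: runs_ask run_k le_k.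
  - by rewrite s's // ffunE.
  - by rewrite s's // ffunE size_map.
  - by rewrite s's // ffunE size_nseq.
  - by rewrite s's // ffunE.
  - by rewrite s's // ffunE.
  - by case=> //= *; rewrite s's // ffunE.
  - by rewrite /ask_time; lia.
apply: runs_eq.
- apply: runs_seq; first exact: ask_k.
  apply: runs_seq.
    apply: ask_k => x ok_x.
    by rewrite assign_neq //; apply: contraTneq ok_x => ->.
  apply: runs_seq.
    apply: ask_k => x ok_x.
    by rewrite !assign_neq //; apply: contraTneq ok_x => ->.
  apply: (@runs_judge _ out bad); first by move=> k; have [] := asked k.
    by elim/ord3_ind; rewrite !ffunE.
  by rewrite !ffunE.
- by apply/ffunP => -[||||||||j|j|j|j]; rewrite !ffunE.
lia.
Qed.

Lemma runs_body gs (test node : bool) inp nodesH done bad out w t :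
  (test -> node -> forall k : 'I_3,
    let q := onehot_query done (size nodesH) (nth [::] gs k) in
    [/\ computes_within T q (out k) t, size (out k) <= m & size q <= w]) ->
  runs body
    (work gs (bit test :: inp) [::] [::] [::] (bit node :: nodesH) done bad)
    (3 * ask_time w t + 4)
    (work gs inp [::] [::] [::] nodesH done.+1
       (bad + (test && ~~ (node && good_answers out)))).
Proof.
move=> asked.
have bitE b : is_true_bit (Some (isym (bit b))) = b by case: b.
apply: runs_eq.
- apply: runs_seq; first exact: runs_alter.
  rewrite !ffunE /= !bitE.
  have -> : assign (work gs (bit test :: inp) [::] [::] [::]
      (bit node :: nodesH) done bad) Bad
      (upd_seq ((if test && ~~ node then push (isym (bit true)) else @keep sym)
         (ohead (nseq bad (isym (bit true))))) ++
       behead (nseq bad (isym (bit true)))) =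
    work gs (bit test :: inp) [::] [::] [::] (bit node :: nodesH) done
      (bad + (test && ~~ node)).
    apply/ffunP => -[||||||||j|j|j|j]; rewrite !ffunE //=.
    by case: ifP => _; rewrite ?pushE ?keepE ?addn1 ?addn0.
  apply: runs_seq.
    (* Both outcomes of the test lead to this store: without a query, the increment reduces to
       [test && ~~ node]. *)
    instantiate (1 := work gs (bit test :: inp) [::] [::] [::]
      (bit node :: nodesH) done
      (bad + (test && ~~ (node && good_answers out)))).
    instantiate (1 := 3 * ask_time w t + 2).
    case test_node: (test && node).
      apply: runs_eq.
      + apply: runs_whenT; first by rewrite !ffunE /= !bitE.
        apply: (@runs_ask_all _ _ _ (size nodesH) _ _ out w t) => //.
        by case/andP: test_node.
      + by case/andP: test_node => -> -> /=; rewrite addn0.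
      + by rewrite -addn1 -addnA.
    apply: runs_eq.
    + by apply: runs_guardF; rewrite !ffunE /= !bitE test_node.
    + by case: test node test_node {asked} => [] [].
    + by lia.
  exact: runs_do.
- apply/ffunP => -[||||||||j|j|j|j]; rewrite !ffunE ?keepE //.
  by rewrite pushE.
by lia.
Qed.

Definition main_loop : prog sym Reg :=
  while (fun tp : tops sym Reg => tp NodesH != None) body.

(** The query at [u] depends on the numbers of nodes before and after it, hence the quantification
    over splittings; [b] counts the nodes already passed, which makes the induction on [us] go
    through. *)
Lemma runs_main_loop U (us : seq U) (test node : pred U) out gs rest b n w t :
  (forall us1 u us2, us = us1 ++ u :: us2 -> test u -> node u ->
     forall k : 'I_3,
     let q := onehot_query (b + size us1) (size us2) (nth [::] gs k) in
     [/\ computes_within T q (out u k) t, size (out u k) <= m & size q <= w]) ->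
  runs main_loop
    (work gs ([seq bit (test u) | u <- us] ++ rest) [::] [::] [::]
       [seq bit (node u) | u <- us] b n)
    (size us * (3 * ask_time w t + 5) + 1)
    (work gs rest [::] [::] [::] [::] (b + size us)
       (n + count (fun u => test u && ~~ (node u && good_answers (out u))) us)).
Proof.
elim: us b n => [|u us IH] b n asked /=.
  rewrite !addn0; apply: runs_eq (runs_guardF _ _ _) _ _ => //.
  by rewrite !ffunE.
apply: runs_eq.
- apply: runs_whileT; first by rewrite !ffunE.
    apply: (@runs_body _ _ _ _ _ _ _ (out u) w t); rewrite size_map => tu nu k.
    by have := asked [::] u us erefl tu nu k; rewrite addn0.
  apply: IH => us1 v us2 def_us tv nv k; rewrite addSnnS.
  by apply: (asked (u :: us1)) => //=; rewrite def_us.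
- by rewrite addSnnS addnA.
by rewrite mulSn; lia.
Qed.

(* The terminating [semi] is only passed on to the stacks in [closed]. *)
Definition seg (closed opened : Reg -> bool) : prog sym Reg :=
  transfer (predC1 (isym semi)) In
    (fun x => if closed x || opened x then Some id else None) ;;
  do_ (fun (tp : tops sym Reg) (x : Reg) =>
    match x with
    | In => Drop
    | _ => if closed x then push (isym semi) (tp x) else keep (tp x)
    end).

Lemma runs_seg closed opened s w rest :
  s In = map isym (w ++ semi :: rest) -> semi \notin w ->
  runs (seg closed opened) s (2 * size w + 2)
    [ffun x => match x with
               | In => map isym rest
               | _ => if closed x then rev (map isym (rcons w semi)) ++ s x
                      else if opened x then rev (map isym w) ++ s x else s x
               end].
Proof.
move=> sIn w_semi; apply: runs_eq.
- apply: runs_seq; last exact: runs_do.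
  apply: (@runs_transfer _ _ _ _ _ _ (map isym w) (map isym (semi :: rest))).
  + by rewrite sIn map_cat.
  + rewrite all_map; apply/allP => c c_w /=.
    by apply: contraNneq w_semi => -[<-].
  + by [].
- apply/ffunP => x; rewrite !ffunE; case: eqP => [->|nIn] //.
  by case: x nIn => // *; rewrite map_rcons rev_rcons;
    case: (closed _); case: (opened _); rewrite /= ?map_id ?pushE ?keepE.
by rewrite size_map; lia.
Qed.

(** Both matrices arrive reversed, so [Tmp] receives the difference in direct order. *)
Definition diff_loop : prog sym Reg :=
  while (fun tp : tops sym Reg => tp AdjG != None)
    (do_ (fun (tp : tops sym Reg) (x : Reg) =>
       match x with
       | AdjG | AdjH => Drop
       | Tmp =>
           match tp AdjG, tp AdjH with
           | Some (inl a), Some (inl b) => push (isym (diff_sym (a, b))) (tp x)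
           | _, _ => keep (tp x)
           end
       | _ => keep (tp x)
       end)).

Lemma runs_diff_loop gs inp tmp u v nodesH done bad : size u = size v ->
  runs diff_loop (work gs inp tmp u v nodesH done bad) (2 * size u + 1)
    (work gs inp (rev (map diff_sym (zip u v)) ++ tmp) [::] [::] nodesH
       done bad).
Proof.
elim: u v tmp => [|a u IH] [|b v] tmp //= => [_|[eq_uv]].
  by apply: runs_eq (runs_guardF _ _ _) _ _ => //; rewrite !ffunE.
apply: runs_eq.
- apply: runs_whileT (runs_do _ _) _; first by rewrite !ffunE.
  rewrite [X in runs _ X](_ : _ = work gs inp (diff_sym (a, b) :: tmp) u v
    nodesH done bad); first exact: IH.
  apply/ffunP => -[||||||||j|j|j|j]; rewrite !ffunE ?keepE //=.
  by rewrite pushE.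
- by rewrite rev_cons cat_rcons.
by rewrite mulnS -addnA.
Qed.

Definition only (k : nat) (x : Reg) : bool :=
  if x is Query_ j then eqn j k else false.
Definition but1 (x : Reg) : bool := if x is Query_ j then ~~ eqn j 1 else false.
Definition no_reg (x : Reg) : bool := false.

(* [Query_ 0], [Query_ 1] and [Query_ 2] receive the encodings of [G], [G_s] and
   [G \ G_s]; the test nodes stay in [In]. *)
Definition prepare : prog sym Reg :=
  seg but1 no_reg ;;
  seg but1 no_reg ;;
  seg (only 0) (fun x => if x is AdjG then true else false) ;;
  seg (only 1) (fun x => if x is Tmp then true else false) ;;
  seg (only 1) no_reg ;;
  seg (only 1) (fun x => if x is AdjH then true else false) ;;
  transfer predT Tmp (fun x => if x is NodesH then Some id else None) ;;
  diff_loop ;;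
  transfer predT Tmp (fun x => if only 2 x then Some id else None) ;;
  alter (Query_ i2) (fun _ => push (isym semi)).

Lemma runs_prepare (u1 u2 u3 u4 u5 u6 rest : seq symbol) :
  semi \notin u1 -> semi \notin u2 -> semi \notin u3 -> semi \notin u4 ->
  semi \notin u5 -> semi \notin u6 -> size u3 = size u6 ->
  let g1 := rcons u1 semi ++ rcons u2 semi in
  let g2 := rcons u4 semi ++ rcons u5 semi in
  let w := g1 ++ rcons u3 semi ++ g2 ++ rcons u6 semi ++ rest in
  runs prepare (input_store _ In w) (6 * size w + 20)
    (work [:: g1 ++ rcons u3 semi; g2 ++ rcons u6 semi;
              g1 ++ rcons (map diff_sym (zip u3 u6)) semi]
       rest [::] [::] [::] u4 0 0).
Proof.
move=> n1 n2 n3 n4 n5 n6 eq36 g1 g2 w.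
(* On reversed stacks, pushing a segment appends it to the stored word. *)
have revE (u v : seq symbol) :
    rev (map isym u) ++ rev (map isym v) = rev (map isym (v ++ u)).
  by rewrite map_cat rev_cat.
have step closed opened (u inp : seq symbol) s s' : semi \notin u ->
    s In = map isym (rcons u semi ++ inp) ->
    s' = [ffun x => match x with
          | In => map isym inp
          | _ => if closed x then rev (map isym (rcons u semi)) ++ s x
                 else if opened x then rev (map isym u) ++ s x else s x
          end] ->
    runs (seg closed opened) s (2 * size u + 2) s'.
  by move=> nu sIn ->; apply: runs_seg => //; rewrite -cat_rcons.
have -> : input_store _ In w = work [::] w [::] [::] [::] [::] 0 0.
  apply/ffunP => x; rewrite !ffunE; case: eqP => [->|] //.
  by case: x => //= *; rewrite nth_nil.
pose inp3 := g2 ++ rcons u6 semi ++ rest.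
pose inp5 := rcons u5 semi ++ rcons u6 semi ++ rest.
apply: runs_eq.
- apply: runs_seq.
    apply: (step _ _ _ _ _
      (work [:: rcons u1 semi; [::]; rcons u1 semi]
         (rcons u2 semi ++ rcons u3 semi ++ inp3) [::] [::] [::] [::] 0 0) n1).
      by rewrite ffunE /w /g1 -!catA.
    apply/ffunP => -[||||||||j|j|j|j]; rewrite !ffunE //=.
      by rewrite /inp3 /g2 -!catA.
    by elim/ord3_ind: j => /=; rewrite ?cats0.
  apply: runs_seq.
    apply: (step _ _ _ _ _
      (work [:: g1; [::]; g1] (rcons u3 semi ++ inp3) [::] [::] [::] [::]
        0 0) n2); rewrite ?ffunE //.
    apply/ffunP => -[||||||||j|j|j|j]; rewrite !ffunE //=.
    by elim/ord3_ind: j => /=; rewrite ?revE.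
  apply: runs_seq.
    apply: (step _ _ _ _ _
      (work [:: g1 ++ rcons u3 semi; [::]; g1] inp3 [::] (rev u3) [::] [::]
        0 0) n3); rewrite ?ffunE //.
    apply/ffunP => -[||||||||j|j|j|j]; rewrite !ffunE //=.
      by rewrite cats0 map_rev.
    by elim/ord3_ind: j => /=; rewrite ?revE.
  apply: runs_seq.
    apply: (step _ _ _ _ _
      (work [:: g1 ++ rcons u3 semi; rcons u4 semi; g1] inp5
         (rev u4) (rev u3) [::] [::] 0 0) n4).
      by rewrite ffunE /inp3 /g2 -!catA.
    apply/ffunP => -[||||||||j|j|j|j]; rewrite !ffunE //=.
      by rewrite cats0 map_rev.
    by elim/ord3_ind: j => /=; rewrite ?cats0.
  apply: runs_seq.
    apply: (step _ _ _ _ _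
      (work [:: g1 ++ rcons u3 semi; g2; g1] (rcons u6 semi ++ rest)
         (rev u4) (rev u3) [::] [::] 0 0) n5); rewrite ?ffunE //.
    apply/ffunP => -[||||||||j|j|j|j]; rewrite !ffunE //=.
    by elim/ord3_ind: j => /=; rewrite ?revE.
  apply: runs_seq.
    apply: (step _ _ _ _ _
      (work [:: g1 ++ rcons u3 semi; g2 ++ rcons u6 semi; g1] rest
         (rev u4) (rev u3) (rev u6) [::] 0 0) n6); rewrite ?ffunE //.
    apply/ffunP => -[||||||||j|j|j|j]; rewrite !ffunE //=.
      by rewrite cats0 map_rev.
    by elim/ord3_ind: j => /=; rewrite ?revE.
  (* The node bits of [G_s] were reversed onto [Tmp]; a second reversal puts the first node on top
     of [NodesH]. *)
  apply: runs_seq.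
    apply: runs_eq (leqnn _).
      apply: (@runs_transfer _ _ predT _ _ _ (map isym (rev u4)) [::]) => //.
        by rewrite ffunE cats0.
      exact: all_predT.
    instantiate (1 := work [:: g1 ++ rcons u3 semi; g2 ++ rcons u6 semi; g1]
      rest [::] (rev u3) (rev u6) u4 0 0).
    apply/ffunP => -[||||||||j|j|j|j]; rewrite !ffunE //=.
    by rewrite cats0 map_id map_rev revK.
  apply: runs_seq; first by apply: runs_diff_loop; rewrite !size_rev.
  rewrite cats0 -rev_zip // map_rev revK.
  apply: runs_seq; last exact: runs_alter.
  apply: (@runs_transfer _ _ predT _ _ _
    (map isym (map diff_sym (zip u3 u6))) [::]) => //.
    by rewrite ffunE cats0.
  exact: all_predT.
- rewrite pushE; apply/ffunP => -[||||||||j|j|j|j]; rewrite !ffunE //=.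
  elim/ord3_ind: j => //=.
  by rewrite map_id revE -rev_rcons -map_rcons -rcons_cat.
rewrite !size_map size_zip eq36 minnn !size_rev.
rewrite /w /g1 /g2 !size_cat !size_rcons.
lia.
Qed.

(** After the loop [In] holds only the [semi] closing the test nodes, so one [Put] leaves exactly
    the verdict. *)
Definition decide : prog sym Reg :=
  prepare ;; main_loop ;;
  alter In (fun tp _ => Put (isym (bit (tp Bad == None)))).

Lemma runs_decide U (us : seq U) (test node : pred U) out
    (u1 u2 u3 u5 u6 : seq symbol) t :
  let u4 := [seq bit (node u) | u <- us] in
  let u7 := [seq bit (test u) | u <- us] in
  semi \notin u1 -> semi \notin u2 -> semi \notin u3 -> semi \notin u5 ->
  semi \notin u6 -> size u3 = size u6 ->
  let g1 := rcons u1 semi ++ rcons u2 semi in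
  let g2 := rcons u4 semi ++ rcons u5 semi in
  let w := g1 ++ rcons u3 semi ++ g2 ++ rcons u6 semi ++ rcons u7 semi in
  let gs := [:: g1 ++ rcons u3 semi; g2 ++ rcons u6 semi;
                g1 ++ rcons (map diff_sym (zip u3 u6)) semi] in
  (forall us1 u us2, us = us1 ++ u :: us2 -> test u -> node u ->
     forall k : 'I_3,
     let q := onehot_query (size us1) (size us2) (nth [::] gs k) in
     size q <= size w ->
     computes_within T q (out u k) t /\ size (out u k) <= m) ->
  exists2 s : store sym Reg, s In = map inl
      [:: bit (all (fun u => test u ==> (node u && good_answers (out u))) us)] &
    runs decide (input_store _ In w)
      (6 * size w + 22 + size w * (3 * ask_time (size w) t + 5)) s.
Proof.
move=> u4 u7 n1 n2 n3 n5 n6 eq36 g1 g2 w gs asked.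
have n4 : semi \notin u4.
  by rewrite /u4; elim: (us) => //= u us' IH; rewrite inE negb_or IH.
(* The segment [u4] has one bit per node, which bounds the number of rounds. *)
have size_us : size us < size w.
  by rewrite /w /g2 !size_cat !size_rcons size_map; lia.
set bad := count (fun u => test u && ~~ (node u && good_answers (out u))) us.
exists (assign (work gs [:: semi] [::] [::] [::] [::] (size us) bad) In
  [:: isym (bit (bad == 0))]).
  rewrite assign_id /=; congr [:: isym (bit _)].
  rewrite /bad -[_ == 0]negbK -lt0n -has_count -all_predC.
  by apply: eq_all => u /=; rewrite negb_and negbK implybE.
apply: runs_eq.
- apply: runs_seq; first exact: runs_prepare.
  apply: runs_seq; last exact: runs_alter.
  rewrite -[rcons u7 semi]cats1.
  apply: (@runs_main_loop _ us test node out gs _ 0 0 (size w) t).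
  move=> us1 u us2 def_us tu nu k q.
  (* [u7] is as long as the one-hot vector, and the rest of the input is at least as long as each of
     the three graph encodings. *)
  have le_q : size q <= size w.
    have size_us1 : size us1 + size us2 < size us.
      by rewrite def_us size_cat /=; lia.
    rewrite /q size_onehot_query /w; elim/ord3_ind: k {q} => /=;
      rewrite !size_cat !size_rcons !size_map ?size_zip; lia.
  by have [] := asked us1 u us2 def_us tu nu k le_q.
- by rewrite !add0n -/bad; congr assign; rewrite !ffunE /=; case: (bad).
rewrite -/g1 -/g2 -/w.
have := leq_mul (ltnW size_us) (leqnn (3 * ask_time (size w) t + 5)); lia.
Qed.

End Decider.

(** * Encodings *)

Lemma computes_within_leq (S : finType) (T : machine S) w out t t' :
  computes_within T w out t -> t <= t' -> computes_within T w out t'.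
Proof.
by case=> halt_t out_t le_t; rewrite /computes_within -(subnK le_t) iterD
  step_iter_halted.
Qed.

(** Natural coefficients make evaluation monotone; this replaces the length of a query by that of
    the whole input in the time bound. *)
Lemma leq_horner (p : {poly nat}) a b : a <= b -> (p.[a]%R <= p.[b]%R)%N.
Proof.
move=> le_ab; elim/poly_ind: p => [|p c IH]; first by rewrite !horner0.
rewrite !hornerD !hornerMX !hornerC; apply: leq_add => //.
exact: leq_mul.
Qed.

(** Twice the bound of [runs_decide] with [ask_time] expanded, since a program step takes two
    machine moves. *)
Definition decide_poly (m : nat) (p : {poly nat}) : {poly nat} :=
  (12%:P * 'X + 44%:P
   + 'X * (36%:P * 'X + 36%:P * p + (12 * m + 130)%N%:P))%R.

Lemma horner_decide_poly m p n : (decide_poly m p).[n]%R =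
  2 * (6 * n + 22 + n * (3 * ask_time m n p.[n]%R + 5)).
Proof.
rewrite /decide_poly !(hornerD, hornerM, hornerX, hornerC) /ask_time.
move: (p.[n])%R => P; rewrite -[LHS]/(12 * n + 44 +
  n * (36 * n + 36 * P + (12 * m + 130))); lia.
Qed.

Section Encodings.
Variable d : nat.

Lemma semi_flatten (ss : seq (seq symbol)) :
  (forall s, s \in ss -> semi \notin s) -> semi \notin flatten ss.
Proof. by move=> ss_ok; apply/flattenP => -[s /ss_ok/negP]. Qed.

Lemma semi_enc_bits n (A : {set 'I_n}) : semi \notin enc_bits A.
Proof. by apply/negP => /mapP[]. Qed.

Lemma semi_enc_nat n : semi \notin enc_nat n.
Proof. by apply/negP => /mapP[]. Qed.

Lemma semi_enc_vec (x : 'rV[rat]_d) : semi \notin enc_vec x.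
Proof.
apply: semi_flatten => _ /mapP[j _ ->].
by rewrite !(inE, mem_cat) !negb_or !semi_enc_nat.
Qed.

Definition enc_feats n (G : graph d n) : seq symbol :=
  flatten [seq enc_vec (feat G i) | i <- enum (nodes G)].

Definition enc_adj n (G : graph d n) : seq symbol :=
  flatten [seq enc_bits [set j | adj G i j] ++ [:: comma] | i <- enum 'I_n].

Lemma semi_enc_feats n (G : graph d n) : semi \notin enc_feats G.
Proof. by apply: semi_flatten => _ /mapP[i _ ->]; apply: semi_enc_vec. Qed.

Lemma semi_enc_adj n (G : graph d n) : semi \notin enc_adj G.
Proof.
apply: semi_flatten => _ /mapP[i _ ->].
by rewrite mem_cat negb_or semi_enc_bits.
Qed.

Lemma enc_graphE n (G : graph d n) : enc_graph G =
  (rcons (enc_bits (nodes G)) semi ++ rcons (enc_feats G) semi)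
  ++ rcons (enc_adj G) semi.
Proof. by rewrite /enc_graph /enc_set !cats1 -!cats1 -!catA. Qed.

(** Rows and columns range over all of ['I_n], not just over the nodes, so the two matrices are
    aligned. *)
Lemma size_enc_adj n (G H : graph d n) : size (enc_adj G) = size (enc_adj H).
Proof.
rewrite !size_flatten /shape -!map_comp; congr sumn; apply: eq_map => i /=.
by rewrite !size_cat !size_map.
Qed.

Lemma enc_adj_remove n (G H : graph d n) :
  enc_adj (remove_edges G H) = map diff_sym (zip (enc_adj G) (enc_adj H)).
Proof.
rewrite /enc_adj; elim: (enum 'I_n) => //= i s IH.
rewrite !zip_cat ?size_cat ?size_map // !map_cat IH /=; congr ((_ ++ _) ++ _).
rewrite zip_map -map_comp; apply: eq_map => j.
by rewrite /= !inE /adj /= inE andbC.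
Qed.

(** [enum] has no repetition, so [v] gives the only one and the nodes on either side give zeros. *)
Lemma enc_onehot n (v : 'I_n) us1 us2 (g : seq symbol) :
  enum 'I_n = us1 ++ v :: us2 ->
  enc_set [set v] ++ g = onehot_query (size us1) (size us2) g.
Proof.
move=> def_enum; have := enum_uniq 'I_n.
rewrite /enc_set /enc_bits def_enum cat_uniq /=.
case/and3P => _ /norP[us1v _] /andP[us2v _].
have zeros us : v \notin us ->
    [seq bit (i \in [set v]) | i <- us] = nseq (size us) (bit false).
  elim: us => //= u us IH; rewrite inE negb_or => /andP[nuv /IH ->].
  by rewrite inE eq_sym (negPf nuv).
rewrite map_cat /= !zeros ?inE ?eqxx //.
by rewrite /onehot_query -!catA.
Qed.

End Encodings.

Lemma size_enc_label (L : finType) (o : option L) : size (enc_label o) <= #|L|.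
Proof. by case: o => [l|] //=; rewrite size_nseq. Qed.

(** Ranks are injective, and their shift by one reserves length 0 for [None]. *)
Lemma size_enc_label_eq (L : finType) (o o' : option L) :
  (size (enc_label o) == size (enc_label o')) = (o == o').
Proof.
case: o o' => [l|] [l'|] //=; rewrite ?size_nseq //.
by rewrite !eqSS (inj_eq val_inj) (inj_eq enum_rank_inj).
Qed.

Lemma good_answers_label (L : finType) (o : 'I_3 -> option L) :
  good_answers (fun k => enc_label (o k)) =
  [&& o ord0 != None, o i1 == o ord0 & o i2 != o ord0].
Proof.
rewrite /good_answers !size_enc_label_eq.
by case: (o ord0) => [l|] //=; rewrite size_nseq.
Qed.

(** * Correctness and running time of the decider for witnesses *)

Theorem lemma3 (d : nat) (L : finType) (M : inference d L)
    (M_undef : undefined_off_nodes M) (M_poly : polytime_inference M) :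
  in_PTIME (@enc_instance d) (is_cw M).
Proof.
case: M_poly => T [p M_T].
pose out (x : cw_instance d) (v : 'I_(cw_order x)) (k : 'I_3) :=
  enc_label (M _ v (nth (cw_graph x) [:: cw_graph x; cw_sub x;
    remove_edges (cw_graph x) (cw_sub x)] k)).
exists (fun x => all (fun v => (v \in cw_tests x) ==>
      ((v \in nodes (cw_sub x)) && good_answers (out x v)))
    (enum 'I_(cw_order x))).
  (* Unary labels have length at most [#|L|], so counters up to this constant suffice. *)
  exists (stack_machine In (decide T #|L|)), (decide_poly #|L| p) => x.
  set w := enc_instance x.
  have w_E : w = (rcons (enc_bits (nodes (cw_graph x))) semi
        ++ rcons (enc_feats (cw_graph x)) semi)
      ++ rcons (enc_adj (cw_graph x)) semi
      ++ (rcons (enc_bits (nodes (cw_sub x))) semi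
        ++ rcons (enc_feats (cw_sub x)) semi)
      ++ rcons (enc_adj (cw_sub x)) semi ++ rcons (enc_bits (cw_tests x)) semi.
    by rewrite /w /enc_instance !enc_graphE /enc_set cats1 -!catA.
  rewrite horner_decide_poly.
  have [||||||us1 v us2 def_enum tv nv k|s s_out run] :=
      @runs_decide T #|L| _ (enum 'I_(cw_order x)) (mem (cw_tests x))
        (mem (nodes (cw_sub x))) (out x) (enc_bits (nodes (cw_graph x)))
        (enc_feats (cw_graph x)) (enc_adj (cw_graph x)) (enc_feats (cw_sub x))
        (enc_adj (cw_sub x)) p.[size w]%R.
  - exact: semi_enc_bits.
  - exact: semi_enc_feats.
  - exact: semi_enc_adj.
  - exact: semi_enc_feats.
  - exact: semi_enc_adj.
  - exact: size_enc_adj.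
  - move=> q; rewrite -w_E => le_q; split; last exact: size_enc_label.
    set Gk := nth (cw_graph x) [:: cw_graph x; cw_sub x;
      remove_edges (cw_graph x) (cw_sub x)] k.
    (* Test nodes lie in [G], hence in [G \ G_s], which keeps all nodes; for [G_s] this is [nv]. *)
    have v_Gk : v \in nodes Gk.
      have vG := subsetP (cw_testsP x) v tv.
      by rewrite /Gk; elim/ord3_ind: (k).
    have qE : q = enc_query (Query v_Gk).
      rewrite /enc_query /= (enc_onehot _ def_enum) /q /Gk; congr onehot_query.
      by elim/ord3_ind: (k) => /=; rewrite enc_graphE ?enc_adj_remove.
    rewrite qE in le_q *.
    by apply: computes_within_leq (M_T (Query v_Gk)) _; apply: leq_horner.
  apply: stack_machine_computes s_out; rewrite w_E in run *.
  exact: run.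
move=> x; rewrite /is_cw; split=> [cw_x|/allP ok v tv].
  apply/allP => v _; apply/implyP => /cw_x[l [[_ MG MH] MD]].
  (* A label on [G_s] forces [v] to be one of its nodes, which justifies the explicit membership
     test. *)
  case: (boolP (v \in nodes (cw_sub x))) => [_|/M_undef]; last by rewrite MH.
  rewrite good_answers_label /= MG MH eqxx /=.
  by apply/eqP.
have := ok v; rewrite mem_enum tv => /(_ isT)/andP[_].
rewrite good_answers_label /=.
(* The label required of the witness is the one [M] gives to [v] on [G]. *)
case MG: (M _ v (cw_graph x)) => [l|] //= /andP[/eqP MH /eqP MD].
by exists l; split=> //; split=> //; apply: cw_subP.
Qed.
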